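(* Let $\mathbb{S}$ and $\mathbb{T}$ be algebraic theories satisfying the following. (S1) For any two $\mathbb{S}$-terms $s_1,s_2$: if $s_1$ contains no variables and $s_1 =_{\mathbb{S}} s_2$, then $s_2$ contains no variables. (S2) For any $\mathbb{S}$-term $s$ and variable $x$: if $s =_{\mathbb{S}} x$, then $\{x\}\vdash s$. (S3) For every $n$-ary operation symbol $\phi_n$ ($n \geq 1$) of $\mathbb{S}$ there is a constant $e_\phi$ of $\mathbb{S}$ which acts as a unit for $\phi_n$: for each $k\le n$, substituting $e_\phi$ for $x_i$ for all $i \neq k$ ($i\le n$) in $\phi_n(x_1,\dots,x_n)$ gives a term provably equal in $\mathbb{S}$ to $x_k$. (S4a) $\mathbb{S}$ has a binary term $\mathbf{s}$ and a constant $e_{\mathbf{s}}$ with $\mathbf{s}(x,e_{\mathbf{s}}) =_{\mathbb{S}} x =_{\mathbb{S}} \mathbf{s}(e_{\mathbf{s}},x)$. (T1) For any two $\mathbb{T}$-terms $t_1,t_2$: if $t_1$ contains no variables and $t_1 =_{\mathbb{T}} t_2$, then $t_2$ contains no variables. (T2) For any $\mathbb{T}$-term $t$ and variable $y$: if $t =_{\mathbb{T}} y$, then $\{y\}\vdash t$. (T3), (T4a) $\mathbb{T}$ has a constant $e_{\mathbf{t}}$ and a binary term $\mathbf{t}$ with $\mathbf{t}(y,e_{\mathbf{t}}) =_{\mathbb{T}} y =_{\mathbb{T}} \mathbf{t}(e_{\mathbf{t}},y)$. Let $\mathbb{U}$ be a composite theory of $\mathbb{S}$ and $\mathbb{T}$.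 Then $\mathbf{s}$ distributes over $\mathbf{t}$: for variables $y_1,y_2,x_0$, $$\mathbf{s}(\mathbf{t}(y_1,y_2), x_0) =_{\mathbb{U}} \mathbf{t}(\mathbf{s}(y_1,x_0),\mathbf{s}(y_2,x_0)),$$ $$\mathbf{s}(x_0, \mathbf{t}(y_1,y_2)) =_{\mathbb{U}} \mathbf{t}(\mathbf{s}(x_0,y_1),\mathbf{s}(x_0,y_2)).$$
   Context: An algebraic theory $\mathbb{T}$ consists of a signature $\Sigma^{\mathbb{T}}$ of finitary operation symbols (each with an arity in $\mathbb{N}$) and a set $E^{\mathbb{T}}$ of pairs of $\Sigma^{\mathbb{T}}$-terms (axioms), over an infinite supply of variables. A constant is a 0-ary term, i.e. a term containing no variables (for instance a 0-ary operation symbol). A binary term is a term in (at most) two variables, and $\mathbf{s}(a,b)$ denotes substitution of $a,b$ for these. $Y \vdash t$ (or $Y\vdash_{\mathbb{T}} t$) means that $t$ is a term (of $\mathbb{T}$) all of whose variables lie in $Y$. $t_1 =_{\mathbb{T}} t_2$ means the terms are provably equal from the axioms in (standard) equational logic. $t[s_i/x_i]$ denotes simultaneous substitution. Composite theory (separating as $\mathbb{T}$-terms of $\mathbb{S}$-terms): a composite of $\mathbb{S}$ and $\mathbb{T}$ is an algebraic theory $\mathbb{U}$ containing both $\mathbb{S}$ and $\mathbb{T}$ (their operations and axioms) such that: 1. Separation: every $\mathbb{U}$-term $u$ satisfies $u =_{\mathbb{U}} t[s_i/x_i]$ for some $\mathbb{T}$-term $t$ and $\mathbb{S}$-terms $s_i$.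 2. Essential uniqueness: whenever $X \vdash_{\mathbb{T}} t$, $X' \vdash_{\mathbb{T}} t'$ and $Y_i\vdash_{\mathbb{S}} s_i$ (for $x_i\in X$), $Y'_{i'}\vdash_{\mathbb{S}} s'_{i'}$ (for $x'_{i'}\in X'$) are such that $t[s_i/x_i] =_{\mathbb{U}} t'[s'_{i'}/x'_{i'}]$, there are a set of variables $Z$ and functions $f: X \to Z$, $f': X' \to Z$ with: (a) $t[f(x_i)/x_i] =_{\mathbb{T}} t'[f'(x'_{i'})/x'_{i'}]$; (b) $f(x_i)=f(x_j) \Leftrightarrow s_i =_{\mathbb{S}} s_j$; (c) $f'(x'_{i'})=f'(x'_{j'}) \Leftrightarrow s'_{i'} =_{\mathbb{S}} s'_{j'}$; (d) $f(x_i)=f'(x'_{j'}) \Leftrightarrow s_i =_{\mathbb{S}} s'_{j'}$. *)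

(* Defs.v *)
From mathcomp Require Import all_boot.

Set Implicit Arguments.
Unset Strict Implicit.
Unset Printing Implicit Defensive.

(* A signature is a family F : nat -> Type, where F n is the set of n-ary
   operation symbols.  The supply of variables is nat.  The arguments of an
   n-ary symbol are indexed from 0, by 'I_n. *)
Inductive term (F : nat -> Type) : Type :=
| Var of nat
| App n of F n & ('I_n -> term F).

Arguments Var {F} x.
Arguments App {F n} phi args.

Section Terms.
Context {F : nat -> Type}.
Implicit Types (t s : term F) (Y : nat -> Prop).

Fixpoint subst (sigma : nat -> term F) t : term F :=
  match t with
  | Var x => sigma x
  | App _ phi args => App phi (fun i => subst sigma (args i))
  end.

Fixpoint occurs (x : nat) t : Prop :=
  match t with
  | Var y => x = y
  | App _ _ args => exists i, occurs x (args i)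
  end.

(* The judgement Y |- t. *)
Definition in_context Y t : Prop := forall x, occurs x t -> Y x.

Definition constant_term t : Prop := forall x, ~ occurs x t.

(* Up to renaming, the two variables of a binary term are 0 and 1. *)
Definition binary t : Prop := in_context (fun x => x < 2) t.

Definition app2 t s1 s2 : term F :=
  subst (fun x => match x with 0 => s1 | 1 => s2 | _ => Var x end) t.

(* The term phi(x_0, ..., x_(n-1)). *)
Definition generic n (phi : F n) : term F := App phi (fun i => Var i).

End Terms.

Fixpoint map_term (F G : nat -> Type) (h : forall n, F n -> G n)
    (t : term F) : term G :=
  match t with
  | Var x => Var x
  | App n phi args => App (h n phi) (fun i => map_term h (args i))
  end.

Record theory : Type := Theory {
  op : nat -> Type;
  ax : term op -> term op -> Prop
}.

Inductive provable (T : theory) : term (op T) -> term (op T) -> Prop :=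
| prov_ax t1 t2 : ax t1 t2 -> provable t1 t2
| prov_refl t : provable t t
| prov_sym t1 t2 : provable t1 t2 -> provable t2 t1
| prov_trans t1 t2 t3 : provable t1 t2 -> provable t2 t3 -> provable t1 t3
| prov_subst (sigma : nat -> term (op T)) t1 t2 :
    provable t1 t2 -> provable (subst sigma t1) (subst sigma t2)
| prov_congr n (phi : op T n) (args1 args2 : 'I_n -> term (op T)) :
    (forall i, provable (args1 i) (args2 i)) ->
    provable (App phi args1) (App phi args2).

Notation "t1 =[ T ] t2" := (@provable T t1 t2)
  (at level 70, T at level 200, t2 at next level,
   format "t1  =[ T ]  t2") : type_scope.

(* U contains S: an arity-preserving injection of the operation symbols of S
   into those of U under which the axioms of S are axioms of U. *)
Record inclusion (S U : theory) : Type := Inclusion {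
  incl_op : forall n, op S n -> op U n;
  incl_op_inj : forall n, injective (@incl_op n);
  incl_ax : forall t1 t2, ax t1 t2 ->
    ax (map_term incl_op t1) (map_term incl_op t2)
}.

Definition incl_term (S U : theory) (i : inclusion S U) :
  term (op S) -> term (op U) := map_term (@incl_op S U i).

Coercion incl_term : inclusion >-> Funclass.

Definition separation (S T U : theory)
    (iS : inclusion S U) (iT : inclusion T U) : Prop :=
  forall u : term (op U),
    exists (t : term (op T)) (s : nat -> term (op S)),
      u =[U] subst (fun x => iS (s x)) (iT t).

(* The families s, s' and the renamings f, f' are total functions on variables,
   but only their restrictions to the contexts X, X' are constrained. *)
Definition essential_uniqueness (S T U : theory)
    (iS : inclusion S U) (iT : inclusion T U) : Prop :=
  forall (X X' : nat -> Prop) (t t' : term (op T))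
         (Y Y' : nat -> nat -> Prop) (s s' : nat -> term (op S)),
    in_context X t -> in_context X' t' ->
    (forall x, X x -> in_context (Y x) (s x)) ->
    (forall x, X' x -> in_context (Y' x) (s' x)) ->
    subst (fun x => iS (s x)) (iT t) =[U] subst (fun x => iS (s' x)) (iT t') ->
    exists (Z : nat -> Prop) (f f' : nat -> nat),
      (forall x, X x -> Z (f x)) /\
      (forall x, X' x -> Z (f' x)) /\
      subst (fun x => Var (f x)) t =[T] subst (fun x => Var (f' x)) t' /\
      (forall x1 x2, X x1 -> X x2 -> (f x1 = f x2 <-> s x1 =[S] s x2)) /\
      (forall x1 x2, X' x1 -> X' x2 -> (f' x1 = f' x2 <-> s' x1 =[S] s' x2)) /\
      (forall x1 x2, X x1 -> X' x2 -> (f x1 = f' x2 <-> s x1 =[S] s' x2)).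

(* T-terms of S-terms. *)
Definition composite (S T U : theory)
    (iS : inclusion S U) (iT : inclusion T U) : Prop :=
  separation iS iT /\ essential_uniqueness iS iT.

(* Main.v *)
(* Absorption: by (S3), plugging a constant c of T for one argument of an
   operation of S, and its unit for the other ones, gives c.  Separating the
   term before plugging in the units, essential uniqueness and (T1) show that
   its outer T-term has no variables, so the term already equals c.

   Now separate s(t(y1, y2), x0) = t'[s_i].  Setting x0 := e_s, essential
   uniqueness and (T2) show that s_i[e_s/x0] is y1 or y2 for each i.  Setting
   y2 := e_t makes the s_i containing y2 collapse to e_t by absorption, and
   leaves s(y1, x0) on the left, so the other s_i equal s(y1, x0) by (T2);
   symmetrically for y1.  The first step also identifies t' with t after
   renaming, whence t'[s_i] = t(s(y1, x0), s(y2, x0)). *)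
Require Import Defs.
From mathcomp Require Import all_boot.
From Stdlib Require Import FunctionalExtensionality.

Set Implicit Arguments.
Unset Strict Implicit.
Unset Printing Implicit Defensive.

(** * Substitution and occurrence of variables *)

Section TermLemmas.
Context {F : nat -> Type}.
Implicit Types (t : term F) (sigma tau : nat -> term F).

Lemma eq_subst_occurs sigma tau t :
  (forall x, occurs x t -> sigma x = tau x) -> subst sigma t = subst tau t.
Proof.
elim: t => [x|n phi args IH] /= eq_st; first exact: eq_st.
congr (App phi _); apply: functional_extensionality => i.
by apply: IH => x x_i; apply: eq_st; exists i.
Qed.

Lemma subst_Var t : subst Var t = t.
Proof.
elim: t => [x|n phi args IH] //=.
by congr (App phi _); apply: functional_extensionality.
Qed.

Lemma subst_id sigma t :
  (forall x, occurs x t -> sigma x = Var x) -> subst sigma t = t.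
Proof. by move=> /eq_subst_occurs ->; exact: subst_Var. Qed.

Lemma subst_subst sigma tau t :
  subst sigma (subst tau t) = subst (fun x => subst sigma (tau x)) t.
Proof.
elim: t => [x|n phi args IH] //=.
by congr (App phi _); apply: functional_extensionality.
Qed.

Lemma occurs_subst sigma t y :
  occurs y (subst sigma t) <-> exists2 x, occurs x t & occurs y (sigma x).
Proof.
elim: t => [x|n phi args IH] /=.
  by split=> [yx|[_ -> //]]; exists x.
split=> [[i /IH [x xi yx]]|[x [i xi] yx]]; first by exists x => //; exists i.
by exists i; apply/IH; exists x.
Qed.

(** An application has finitely many arguments, so a search through them decides; later case splits
    on occurrence rest on this. *)
Lemma occurs_dec x t : decidable (occurs x t).
Proof.
elim: t => [y|n phi args IH] /=; first exact: decP (x =P y).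
case: (pickP (fun i => IH i : bool)) => [i|none].
  by case: (IH i) => // xi _; left; exists i.
by right=> -[i xi]; move: (none i); case: (IH i).
Qed.

End TermLemmas.

(** * Translation of terms between signatures, and provable equality *)

Lemma occurs_map_term (F G : nat -> Type) (h : forall n, F n -> G n) t x :
  occurs x (map_term h t) <-> occurs x t.
Proof.
elim: t => [y|n phi args IH] //=.
by split=> -[i /IH xi]; exists i.
Qed.

Lemma map_term_subst (F G : nat -> Type) (h : forall n, F n -> G n) sigma t :
  map_term h (subst sigma t) =
  subst (fun x => map_term h (sigma x)) (map_term h t).
Proof.
elim: t => [y|n phi args IH] //=.
by congr (App _ _); apply: functional_extensionality.
Qed.

Lemma provable_subst_occurs (T : theory) (sigma tau : nat -> term (op T)) t :
  (forall x, occurs x t -> sigma x =[T] tau x) ->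
  subst sigma t =[T] subst tau t.
Proof.
elim: t => [x|n phi args IH] /= eq_st; first exact: eq_st.
by apply: prov_congr => i; apply: IH => x x_i; apply: eq_st; exists i.
Qed.

Lemma provable_incl (S U : theory) (i : inclusion S U) t1 t2 :
  t1 =[S] t2 -> i t1 =[U] i t2.
Proof.
elim=> {t1 t2} [t1 t2 a|t|t1 t2 _|t1 t2 t3 _ p1 _|sigma t1 t2 _ p|
                n phi a1 a2 _ p].
- exact: prov_ax (incl_ax i a).
- exact: prov_refl.
- exact: prov_sym.
- exact: prov_trans.
- by rewrite /incl_term !map_term_subst; apply: prov_subst.
- exact: prov_congr.
Qed.

(** * Essential uniqueness and absorption of constants *)

Section Composite.
Context {S T U : theory} (iS : inclusion S U) (iT : inclusion T U).

Lemma incl_subst (V : theory) (i : inclusion V U) sigma t :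
  i (subst sigma t) = subst (fun x => i (sigma x)) (i t).
Proof. exact: map_term_subst. Qed.

(** All contexts are taken to be the full set of variables, which makes the context conditions
    vacuous. *)
Lemma essential_uniquenessT (t t' : term (op T)) (s s' : nat -> term (op S)) :
  essential_uniqueness iS iT ->
  subst (fun x => iS (s x)) (iT t) =[U] subst (fun x => iS (s' x)) (iT t') ->
  exists f f' : nat -> nat,
    [/\ subst (fun x => Var (f x)) t =[T] subst (fun x => Var (f' x)) t',
        forall x1 x2, f x1 = f x2 <-> s x1 =[S] s x2
      & forall x1 x2, f x1 = f' x2 <-> s x1 =[S] s' x2].
Proof.
move=> EU eq_u; pose A (_ : nat) := True; pose B (_ _ : nat) := True.
have [] // := EU A A t t' B B s s'.
move=> _ [f [f' [_ [_ [eq_t [eq_f [_ eq_ff']]]]]]].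
by exists f, f'; split=> // x1 x2; [apply: eq_f | apply: eq_ff'].
Qed.

Hypothesis T1 : forall t1 t2 : term (op T),
  constant_term t1 -> t1 =[T] t2 -> constant_term t2.
Hypothesis T2 : forall (t : term (op T)) (y : nat),
  t =[T] Var y -> in_context (fun x => x = y) t.
Hypothesis HU : composite iS iT.

(** [sigma] changes only the inner terms of a separated form of [u], so [c] equals a renaming of its
    outer term; [T1] makes that term closed, and no inner term is left in [u] itself. *)
Lemma constant_absorbs (c : term (op T)) (u : term (op U))
    (sigma : nat -> term (op S)) :
  constant_term c -> subst (fun x => iS (sigma x)) u =[U] iT c -> u =[U] iT c.
Proof.
have [sep EU] := HU; move=> c_const u_c.
have [t [s u_ts]] := sep u.
have: subst (fun x => iS (Var x)) (iT c) =[U]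
      subst (fun x => iS (subst sigma (s x))) (iT t).
  rewrite subst_Var; apply: prov_trans (prov_sym u_c) _.
  apply: prov_trans (prov_subst _ u_ts) _; rewrite subst_subst.
  by apply: provable_subst_occurs => x _; rewrite -incl_subst; apply: prov_refl.
case/(essential_uniquenessT EU) => f [f' [c_t _ _]].
rewrite subst_id in c_t; last by move=> x /c_const.
have t_const : constant_term t.
  move=> x xt; apply: (T1 c_const c_t (x := f' x)).
  by apply/occurs_subst; exists x.
rewrite subst_id in c_t; last by move=> x /t_const.
apply: prov_trans u_ts _; rewrite subst_id => [|x /occurs_map_term /t_const //].
exact/provable_incl/prov_sym.
Qed.

Hypothesis S3 : forall (n : nat) (phi : op S n), 0 < n ->
  exists e : term (op S), constant_term e /\
    forall k : 'I_n,
      subst (fun i : nat => if i == k then Var i else e) (generic phi)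
        =[S] Var k.

Lemma op_absorbs n (phi : op S n) (k : 'I_n) (c : term (op T))
    (args : 'I_n -> term (op U)) :
  constant_term c -> args k =[U] iT c -> App (incl_op iS phi) args =[U] iT c.
Proof.
move=> c_const k_c.
have [|e [e_const phi_e]] := S3 phi; first exact: leq_ltn_trans (ltn_ord k).
(* The arguments other than [k] stay variables, so that closing them by [e] gives the unit law and
   [constant_absorbs] applies; [args] is substituted afterwards. *)
pose rho (x : nat) := if x == k then iT c else Var x.
have rho_c : subst rho (iS (generic phi)) =[U] iT c.
  apply: (constant_absorbs (sigma := fun=> e)) => //.
  have := prov_subst (fun=> iT c) (provable_incl iS (phi_e k)).
  rewrite incl_subst subst_subst /= => phi_c.
  apply: prov_trans phi_c; apply: prov_congr => x; rewrite /rho.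
  case: eqP => _ /=.
    by rewrite subst_id => [|y /occurs_map_term /c_const //]; apply: prov_refl.
  by rewrite subst_id => [|y /occurs_map_term /e_const //]; apply: prov_refl.
(* [insub] extends [args] to all numbers; the default is never reached, as [generic phi] has only
   variables below [n]. *)
pose tau x := if insub x is Some i then args i else Var x.
have := prov_subst tau rho_c.
rewrite [subst tau (iT c)]subst_id => [tau_c|y /occurs_map_term /c_const //].
apply: prov_trans tau_c; apply: prov_congr => i /=; rewrite /rho /=.
case: eqP => [/val_inj ->|_] /=; last by rewrite /tau valK; apply: prov_refl.
rewrite -[X in _ =[U] X]/(subst tau (iT c)).
by rewrite subst_id => [|y /occurs_map_term /c_const].
Qed.

(** The constant climbs from an occurrence of [k] to the root, one [op_absorbs] per operation. *)
Lemma term_absorbs (s : term (op S)) (k : nat) (c : term (op T)) rho :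
  constant_term c -> occurs k s -> rho k = iT c ->
  subst rho (iS s) =[U] iT c.
Proof.
move=> c_const ks rho_k; elim: s ks => [x /= <-|n phi args IH /= [i ki]].
  by rewrite rho_k; apply: prov_refl.
by apply: (@op_absorbs _ phi i) => //; apply: IH.
Qed.

(** * Inner terms of the separated form, and distributivity *)

Hypothesis S1 : forall s1 s2 : term (op S),
  constant_term s1 -> s1 =[S] s2 -> constant_term s2.
Hypothesis S2 : forall (s : term (op S)) (x : nat),
  s =[S] Var x -> in_context (fun y => y = x) s.

(** [S2] leaves [k] as the only candidate; without it [s] would be closed, and [S1] would make
    [Var k] closed. *)
Lemma occurs_of_eq_Var s k : s =[S] Var k -> occurs k s.
Proof.
move=> s_k; case: (occurs_dec k s) => // nks.
have s_const : constant_term s by move=> x xs; apply: nks; rewrite -(S2 s_k xs).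
by case: (S1 s_const s_k (x := k)).
Qed.

(* Terms [s i] containing [k] become [c] and disappear into the outer term;
   essential uniqueness and T2 then identify the others with [p]. *)
Lemma inner_terms_eq (u : term (op U)) (t : term (op T)) (c : term (op T))
    (s : nat -> term (op S)) (p : term (op S)) (k : nat) (b : pred nat) :
  constant_term c ->
  u =[U] subst (fun i => iS (s i)) (iT t) ->
  subst (fun x => if x == k then iT c else Var x) u =[U] iS p ->
  (forall i, occurs i t -> b i <-> occurs k (s i)) ->
  forall i, occurs i t -> ~~ b i -> s i =[S] p.
Proof.
move=> c_const u_ts u_p b_k i it nbi; have [_ EU] := HU.
pose t1 := subst (fun i => if b i then c else Var i) t.
(* [p] counts as a separated form whose outer term is a variable, so that [T2] applies to the
   renamed [t1]. *)
have /(essential_uniquenessT EU) [f [f' [f_t1 _ f_s]]] :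
    subst (fun=> iS p) (iT (Var 0)) =[U] subst (fun i => iS (s i)) (iT t1).
  apply: prov_trans (prov_sym u_p) _.
  apply: prov_trans (prov_subst _ u_ts) _.
  rewrite /t1 incl_subst !subst_subst.
  apply: provable_subst_occurs => x /occurs_map_term xt.
  have [/(b_k x xt) ks|nbx] := boolP (b x).
    rewrite [X in _ =[U] X]subst_id => [|y /occurs_map_term /c_const //].
    by apply: (term_absorbs (k := k)) => //; rewrite eqxx.
  rewrite subst_id => [|y /occurs_map_term ys] /=; first exact: prov_refl.
  by case: eqP => // yk; case/negP: nbx; apply/(b_k x xt); rewrite -yk.
apply/prov_sym/(f_s 0 i)/esym.
apply: (T2 (prov_sym f_t1)); apply/occurs_subst; exists i => //.
by apply/occurs_subst; exists i => //; rewrite (negbTE nbi).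
Qed.

(* The hole of [r] is the variable 0; 1 is kept free for the second argument of
   [t], and all other variables of [r] are parameters. *)
Lemma unital_term_distributes (r e : term (op S)) (t c : term (op T)) :
  ~ occurs 1 r -> constant_term e ->
  subst (fun x => if x is 0 then Var 0 else e) r =[S] Var 0 ->
  binary t -> constant_term c ->
  subst (fun x => if x == 1 then c else Var x) t =[T] Var 0 ->
  subst (fun x => if x == 0 then c else Var x) t =[T] Var 1 ->
  subst (fun x => if x is 0 then iT t else Var x) (iS r) =[U]
  subst (fun j => iS (subst (fun x => if x is 0 then Var j else Var x) r)) (iT t).
Proof.
move=> r1 e_const r_e t_bin c_const t_l t_r; have [sep EU] := HU.
set u := subst _ (iS r).
pose p (j : nat) := subst (fun x => if x is 0 then Var j else Var x) r.
have [t' [s u_ts]] := sep u.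
(* [sigma] fixes the variables of [t] and closes the parameters of [r], so it turns [u] into [t]. *)
pose sigma x : term (op S) := if x < 2 then Var x else e.
have /(essential_uniquenessT EU) [f [f' [f_t f_inj f_s]]] :
    subst (fun x => iS (Var x)) (iT t) =[U]
    subst (fun x => iS (subst sigma (s x))) (iT t').
  apply: prov_trans (_ : subst (fun x => iS (sigma x)) u =[U] _); last first.
    apply: prov_trans (prov_subst _ u_ts) _; rewrite subst_subst.
    by apply: provable_subst_occurs => x _; rewrite -incl_subst; apply: prov_refl.
  have := prov_subst (fun=> iT t) (provable_incl iS r_e).
  rewrite incl_subst subst_subst subst_Var /= => r_t.
  apply: prov_trans (prov_sym r_t) _; rewrite /u subst_subst.
  apply: provable_subst_occurs => -[|[|x]] /occurs_map_term // xr /=.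
    rewrite subst_id => [|y /occurs_map_term /t_bin y2]; first exact: prov_refl.
    by rewrite /sigma y2.
  by rewrite subst_id => [|y /occurs_map_term /e_const //]; apply: prov_refl.
have f01 : f 0 <> f 1.
  by move/f_inj/prov_sym => /S2 /(_ 1 erefl).
(* Replacing [f 1] by [c] collapses the renamed [t] to [Var (f 0)] by the unit law; [T2] then
   excludes every other variable from the renamed [t']. *)
have f'_01 i : occurs i t' -> f' i <> f 1 -> f' i = f 0.
  move=> it /eqP/negbTE f'i.
  pose rho z : term (op T) := if z == f 1 then c else Var z.
  have t'_0 : subst rho (subst (fun x => Var (f' x)) t') =[T] Var (f 0).
    apply: prov_trans (prov_sym (prov_subst rho f_t)) _.
    apply: prov_trans (prov_subst (fun x => Var (f x)) t_l).
    rewrite !subst_subst; apply: provable_subst_occurs.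
    move=> [|[|x]] /t_bin //= _; rewrite /rho.
      by case: eqP => //= _; apply: prov_refl.
    by rewrite eqxx subst_id => [|y /c_const //]; apply: prov_refl.
  apply: (T2 t'_0); apply/occurs_subst; exists (f' i).
    by apply/occurs_subst; exists i.
  by rewrite /rho f'i.
(* [k] is the variable of [t] set to [c] and [j] the surviving one; both orders are used. *)
have s_p j k : k < 2 -> j <> k ->
    subst (fun x => if x == k then c else Var x) t =[T] Var j ->
    (forall i, occurs i t' -> f' i <> f k -> f' i = f j) ->
    forall i, occurs i t' -> f' i <> f k -> s i =[S] p j.
  move=> k2 jk t_j f'_j i it /eqP; move: i it.
  apply: (inner_terms_eq c_const u_ts (k := k) (b := fun i => f' i == f k)).
    rewrite /u /p subst_subst incl_subst.
    apply: provable_subst_occurs => -[|[|x]] /occurs_map_term // _ /=.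
      by have := provable_incl iT t_j; rewrite incl_subst; congr (provable _ _);
        apply: eq_subst_occurs => x _; case: eqP.
    by case: eqP => [xk|_]; [rewrite -xk in k2 | apply: prov_refl].
  (* If [f' i = f k], closing the parameters of [s i] gives [Var k], so [k] occurs in [s i];
     otherwise it gives [Var j], and [S2] excludes [k]. *)
  move=> i it; split=> [/eqP/esym/f_s/prov_sym/occurs_of_eq_Var|ks].
    case/occurs_subst => x xs; rewrite /sigma.
    by case: ifP => _ /= => [-> // | /e_const].
  case: eqP => // /(f'_j i it)/esym/f_s/prov_sym/S2 s_j.
  case: jk; apply/esym/s_j; apply/occurs_subst; exists k => //.
  by rewrite /sigma k2.
(* The boolean is coerced to 0 or 1, the index of a variable of [t]. *)
have {s_p} s_p i : occurs i t' -> s i =[S] p (f' i == f 1).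
  move=> it; case: eqP => f'i.
    apply: (s_p 1 0) => // [k kt nf0|]; last by rewrite f'i => /esym.
    by case: (f' k =P f 1) => // /(f'_01 k kt).
  exact: (s_p 0 1).
apply: prov_trans u_ts _.
(* [h] sends [f 0] and [f 1] to [p 0] and [p 1]; applied to [f_t], it exchanges [t'] for [t]. *)
pose h z := iS (p (z == f 1)).
apply: prov_trans (_ : subst (fun i => h (f' i)) (iT t') =[U] _).
  by apply: provable_subst_occurs => i /occurs_map_term /s_p; apply: provable_incl.
have := prov_subst h (prov_sym (provable_incl iT f_t)).
rewrite !incl_subst !subst_subst => t'_t; apply: prov_trans t'_t _.
apply: provable_subst_occurs => -[|[|x]] /occurs_map_term /t_bin // _ /=.
  by rewrite /h; case: eqP => // _; apply: prov_refl.
by rewrite /h eqxx; apply: prov_refl.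
Qed.

End Composite.

Theorem theorem4p13 (S T : theory)
  (S1 : forall s1 s2 : term (op S), constant_term s1 -> s1 =[S] s2 -> constant_term s2)
  (S2 : forall (s : term (op S)) (x : nat),
      s =[S] Var x -> in_context (fun y => y = x) s)
  (S3 : forall (n : nat) (phi : op S n), 0 < n ->
      exists e : term (op S), constant_term e /\
        forall k : 'I_n,
          subst (fun i : nat => if i == k then Var i else e) (generic phi)
            =[S] Var k)
  (s e_s : term (op S))
  (S4a_s : binary s) (S4a_e : constant_term e_s)
  (S4a_r : forall x : nat, app2 s (Var x) e_s =[S] Var x)
  (S4a_l : forall x : nat, Var x =[S] app2 s e_s (Var x))
  (T1 : forall t1 t2 : term (op T), constant_term t1 -> t1 =[T] t2 -> constant_term t2)
  (T2 : forall (t : term (op T)) (y : nat),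
      t =[T] Var y -> in_context (fun x => x = y) t)
  (t e_t : term (op T))
  (T4a_t : binary t) (T3 : constant_term e_t)
  (T4a_r : forall y : nat, app2 t (Var y) e_t =[T] Var y)
  (T4a_l : forall y : nat, Var y =[T] app2 t e_t (Var y))
  (U : theory) (iS : inclusion S U) (iT : inclusion T U)
  (HU : composite iS iT) :
  forall y1 y2 x0 : nat,
    app2 (iS s) (app2 (iT t) (Var y1) (Var y2)) (Var x0)
      =[U] app2 (iT t) (app2 (iS s) (Var y1) (Var x0))
                       (app2 (iS s) (Var y2) (Var x0))
    /\
    app2 (iS s) (Var x0) (app2 (iT t) (Var y1) (Var y2))
      =[U] app2 (iT t) (app2 (iS s) (Var x0) (Var y1))
                       (app2 (iS s) (Var x0) (Var y2)).
Proof.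
move=> y1 y2 x0.
have unit_l : subst (fun x => if x == 1 then e_t else Var x) t =[T] Var 0.
  apply: prov_trans (T4a_r 0); apply: provable_subst_occurs.
  by move=> [|[|x]] /T4a_t // _; apply: prov_refl.
have unit_r : subst (fun x => if x == 0 then e_t else Var x) t =[T] Var 1.
  apply: prov_trans (prov_sym (T4a_l 1)); apply: provable_subst_occurs.
  by move=> [|[|x]] /T4a_t // _; apply: prov_refl.
(* The law is obtained at the distinct variables 0, 1, 2 and then renamed, since [y1], [y2], [x0]
   may coincide. *)
pose rho x : term (op U) :=
  match x with 0 => Var y1 | 1 => Var y2 | _ => Var x0 end.
have distr r r1 r_e :=
  prov_subst rho (unital_term_distributes T1 T2 HU S3 S1 S2 (r := r) r1 S4a_e
                    r_e T4a_t T3 unit_l unit_r).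
split.
- have r1 : ~ occurs 1 (app2 s (Var 0) (Var 2)).
    by case/occurs_subst => -[|[|x]] // /S4a_s.
  have r_e : subst (fun x => if x is 0 then Var 0 else e_s)
      (app2 s (Var 0) (Var 2)) =[S] Var 0.
    apply: prov_trans (S4a_r 0); rewrite /app2 subst_subst.
    by apply: provable_subst_occurs => -[|[|x]] /S4a_s // _; apply: prov_refl.
  have := distr _ r1 r_e; rewrite /app2 !incl_subst !subst_subst => r_t.
  apply: prov_trans (prov_trans _ r_t) _.
    apply: provable_subst_occurs => -[|[|x]] /occurs_map_term /S4a_s // _ /=.
      apply: provable_subst_occurs => -[|[|x]] /occurs_map_term /T4a_t // _.
        exact: prov_refl.
      exact: prov_refl.
    exact: prov_refl.
  apply: provable_subst_occurs => -[|[|x]] /occurs_map_term /T4a_t // _ /=;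
    rewrite !incl_subst !subst_subst;
    apply: provable_subst_occurs => -[|[|x]] /occurs_map_term /S4a_s // _;
    exact: prov_refl.
(* The hole is now the second argument of [s], so the left unit law is the one that applies. *)
- have r1 : ~ occurs 1 (app2 s (Var 2) (Var 0)).
    by case/occurs_subst => -[|[|x]] // /S4a_s.
  have r_e : subst (fun x => if x is 0 then Var 0 else e_s)
      (app2 s (Var 2) (Var 0)) =[S] Var 0.
    apply: prov_trans (prov_sym (S4a_l 0)); rewrite /app2 subst_subst.
    by apply: provable_subst_occurs => -[|[|x]] /S4a_s // _; apply: prov_refl.
  have := distr _ r1 r_e; rewrite /app2 !incl_subst !subst_subst => r_t.
  apply: prov_trans (prov_trans _ r_t) _.
    apply: provable_subst_occurs => -[|[|x]] /occurs_map_term /S4a_s // _ /=.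
      exact: prov_refl.
    apply: provable_subst_occurs => -[|[|x]] /occurs_map_term /T4a_t // _.
      exact: prov_refl.
    exact: prov_refl.
  apply: provable_subst_occurs => -[|[|x]] /occurs_map_term /T4a_t // _ /=;
    rewrite !incl_subst !subst_subst;
    apply: provable_subst_occurs => -[|[|x]] /occurs_map_term /S4a_s // _;
    exact: prov_refl.
Qed.
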